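(* The construction which associates to a generalized cat$^1$-group $(G,s,t)$ the generalized crossed module $(\ker s,\operatorname{Im} s,t|_{\ker s})$ (where $\ker s$ and $\operatorname{Im} s$ carry the self-actions induced from that of $G$, and $\operatorname{Im} s$ acts on $\ker s$ by $x\cdot g={}^{x}{g}$ for $g\in\ker s$, $x\in\operatorname{Im} s$) defines a functor from the category of generalized cat$^1$-groups to the category of generalized crossed modules.
   Context: Groups are written additively (not necessarily abelian). All actions of a group on a group are left actions by group automorphisms. A group with action is a group $G$ together with an action of $G$ on itself, written ${}^{g}{g_1}$ (not necessarily conjugation). A morphism of groups with action $f\colon G\to H$ is a group homomorphism with $f({}^{g}{g_1})={}^{f(g)}{f(g_1)}$ for all $g,g_1\in G$. A generalized cat$^1$-group $(G,s,t)$ is a group with action $G$ with two morphisms of groups with action $s,t\colon G\to G$ such that (i) $st=t$ and $ts=s$; (ii) ${}^{y}{x}=x$ for all $x\in\ker s$ and $y\in\ker t$. A morphism $(G,s,t)\to(G',s',t')$ is a morphism of groups with action $f\colon G\to G'$ with $fs=s'f$ and $ft=t'f$. A generalized crossed module $(A,B,\alpha)$ consists of two groups with action $A,B$, a group homomorphism $\alpha\colon A\to B$ and an action $b\cdot a$ of the group $B$ on the group $A$ such that (i) $\alpha(b\cdot a)={}^{b}{\alpha(a)}$ and (ii) $\alpha(a)\cdot a_1={}^{a}{a_1}$ for all $a,a_1\in A$, $b\in B$. A morphism $\langle f,g\rangle\colon (A,B,\alpha)\to(A',B',\alpha')$ is a pair of group homomorphisms $f\colon A\to A'$, $g\colon B\to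 B'$ with $g\alpha=\alpha' f$ and $f(b\cdot a)=g(b)\cdot f(a)$ for all $a\in A$, $b\in B$; composition is componentwise. *)

(* Defs.v *)
From HB Require Import structures.
From mathcomp Require Import all_boot.
From mathcomp Require Import boolp classical_sets.

Set Implicit Arguments.
Unset Strict Implicit.
Unset Printing Implicit Defensive.

Local Open Scope group_scope.

(* Arbitrary, possibly infinite and nonabelian, groups are [groupType]s. The
   library writes them multiplicatively: [x * y] and [1] stand for the additive
   x + y and 0. *)

(* Left action of the group [B] on the group [A] by group automorphisms; each
   [act b] is bijective, with inverse [act b^-1]. *)
Record is_group_action (B A : groupType) (act : B -> A -> A) : Prop :=
  IsGroupAction {
    group_act1 : forall a, act 1 a = a;
    group_actM : forall b c a, act (b * c) a = act b (act c a);
    group_act_morph : forall b a a', act b (a * a') = act b a * act b a' }.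

HB.mixin Record hasSelfAction G of Group G := {
  selfact : G -> G -> G;
  selfactP : is_group_action selfact
}.

#[short(type="gwaType")]
HB.structure Definition GroupWithAction := {G of hasSelfAction G & Group G}.

HB.mixin Record isSelfActMorphism (G H : gwaType) (f : G -> H) := {
  gwa_selfact : forall g h : G, f (selfact g h) = selfact (f g) (f h)
}.

HB.structure Definition GwaMorphism (G H : gwaType) :=
  {f of isSelfActMorphism G H f & isMultiplicative G H f}.

Notation "{ 'gwa' G -> H }" := (GwaMorphism.type G%type H%type)
  (at level 0, G at level 98, H at level 99,
   format "{ 'gwa'  G  ->  H }") : type_scope.

Section GwaMorphismInstances.
Variables (G H K : gwaType) (g : {gwa H -> K}) (f : {gwa G -> H}).

Let idfun_selfact (x y : G) : idfun (selfact x y) = selfact (idfun x) (idfun y).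
Proof. by []. Qed.
HB.instance Definition _ := isSelfActMorphism.Build G G idfun idfun_selfact.

Let comp_selfact (x y : G) :
  (g \o f) (selfact x y) = selfact ((g \o f) x) ((g \o f) y).
Proof. by rewrite /= !gwa_selfact. Qed.
HB.instance Definition _ := isSelfActMorphism.Build G K (g \o f) comp_selfact.

End GwaMorphismInstances.

Lemma multiplicative_ext (G H : magmaType) (f g : {multiplicative G -> H}) :
  f =1 g -> f = g.
Proof.
case: f g => [f [[fM]]] [g [[gM]]] /= /funext fg.
by case: _ / fg gM => gM; rewrite (Prop_irrelevance fM gM).
Qed.

Lemma gwa_ext (G H : gwaType) (f g : {gwa G -> H}) : f =1 g -> f = g.
Proof.
case: f g => [f [[fM] [fA]]] [g [[gM] [gA]]] /= /funext fg.
case: _ / fg gM gA => gM gA.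
by rewrite (Prop_irrelevance fM gM) (Prop_irrelevance fA gA).
Qed.

Section KernelImage.
Variables (G H : gwaType) (f : {gwa G -> H}).

Definition gwa_ker := {x : G | f x == 1}.
HB.instance Definition _ := [isSub of gwa_ker for @sval G (fun x => f x == 1)].
HB.instance Definition _ := [Choice of gwa_ker by <:].

Let gwaf1 : f 1 = 1.
Proof. by apply: (@mulgI _ (f 1)); rewrite -gmulfM !mulg1. Qed.

Let gwafV x : f x^-1 = (f x)^-1.
Proof. by apply: (@mulgI _ (f x)); rewrite -gmulfM !mulgV; exact: gwaf1. Qed.

Let ker_group_closed : group_closed (fun x => f x == 1).
Proof.
split=> [|x y]; rewrite !unfold_in; first exact/eqP/gwaf1.
by move=> /eqP fx /eqP fy; rewrite gmulfM /= gwafV fx fy mulgV.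
Qed.
HB.instance Definition _ :=
  SubChoice_isSubGroup.Build G (fun x => f x == 1) gwa_ker ker_group_closed.

Let selfactr1 (K : gwaType) (x : K) : selfact x 1 = 1.
Proof.
apply: (@mulgI _ (selfact x 1)).
by rewrite -(group_act_morph selfactP) !mulg1.
Qed.

Let ker_selfact_subproof (x y : gwa_ker) : f (selfact (val x) (val y)) == 1.
Proof. by rewrite gwa_selfact (eqP (valP y)) selfactr1. Qed.

Definition gwa_ker_selfact (x y : gwa_ker) : gwa_ker :=
  Sub (selfact (val x) (val y)) (ker_selfact_subproof x y).

Let ker_selfactP : is_group_action gwa_ker_selfact.
Proof.
split=> [a|b c a|b a a']; apply: val_inj => /=.
- exact: (group_act1 selfactP).
- exact: (group_actM selfactP).
- exact: (group_act_morph selfactP).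
Qed.
HB.instance Definition _ := hasSelfAction.Build gwa_ker ker_selfactP.

Definition gwa_im := {y : H | y \in range f}.
HB.instance Definition _ := [isSub of gwa_im for @sval H (fun y => y \in range f)].
HB.instance Definition _ := [Choice of gwa_im by <:].

Let im_group_closed : group_closed (fun y => y \in range f).
Proof.
split=> [|x y]; rewrite !unfold_in.
  by apply/asboolP; exists 1.
move=> /asboolP[a _ <-] /asboolP[b _ <-].
by apply/asboolP; exists (a / b) => //; rewrite gmulfM /= gwafV.
Qed.
HB.instance Definition _ :=
  SubChoice_isSubGroup.Build H (fun y => y \in range f) gwa_im im_group_closed.

Let im_selfact_subproof (x y : gwa_im) : selfact (val x) (val y) \in range f.
Proof.
move: (valP x) (valP y) => /set_mem[a _ <-] /set_mem[b _ <-].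
by apply/mem_set; exists (selfact a b); rewrite ?gwa_selfact.
Qed.

Definition gwa_im_selfact (x y : gwa_im) : gwa_im :=
  Sub (selfact (val x) (val y)) (im_selfact_subproof x y).

Let im_selfactP : is_group_action gwa_im_selfact.
Proof.
split=> [a|b c a|b a a']; apply: val_inj => /=.
- exact: (group_act1 selfactP).
- exact: (group_actM selfactP).
- exact: (group_act_morph selfactP).
Qed.
HB.instance Definition _ := hasSelfAction.Build gwa_im im_selfactP.

End KernelImage.

(* Categories, with Leibniz equality of morphisms. *)
Record category := Category {
  obj :> Type;
  hom : obj -> obj -> Type;
  idm : forall X, hom X X;
  compm : forall X Y Z, hom Y Z -> hom X Y -> hom X Z;
  comp1m : forall X Y (f : hom X Y), compm (idm Y) f = f;
  compm1 : forall X Y (f : hom X Y), compm f (idm X) = f;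
  compmA : forall X Y Z T (h : hom Z T) (g : hom Y Z) (f : hom X Y),
    compm h (compm g f) = compm (compm h g) f }.

Arguments idm {c} X.
Arguments compm {c X Y Z} g f.

(* A functor whose object map is [F]. *)
Record functor_on (C D : category) (F : C -> D) := FunctorOn {
  fmap : forall X Y, hom X Y -> hom (F X) (F Y);
  fmap_id : forall X, fmap (idm X) = idm (F X);
  fmap_comp : forall X Y Z (g : hom Y Z) (f : hom X Y),
    fmap (compm g f) = compm (fmap g) (fmap f) }.

Arguments fmap {C D F} _ {X Y} _.

Record gcat1 := GCat1 {
  gcat1_sort :> gwaType;
  gcat1_s : {gwa gcat1_sort -> gcat1_sort};
  gcat1_t : {gwa gcat1_sort -> gcat1_sort};
  gcat1_st : gcat1_s \o gcat1_t =1 gcat1_t;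
  gcat1_ts : gcat1_t \o gcat1_s =1 gcat1_s;
  gcat1_ker : forall x y : gcat1_sort,
    gcat1_s x = 1 -> gcat1_t y = 1 -> selfact y x = x }.

Record gcat1_hom (C D : gcat1) := GCat1Hom {
  gcat1_hom_fun :> {gwa C -> D};
  gcat1_hom_s : gcat1_hom_fun \o gcat1_s C =1 gcat1_s D \o gcat1_hom_fun;
  gcat1_hom_t : gcat1_hom_fun \o gcat1_t C =1 gcat1_t D \o gcat1_hom_fun }.

Lemma gcat1_hom_ext (C D : gcat1) (f g : gcat1_hom C D) : f =1 g -> f = g.
Proof.
case: f g => [f fs ft] [g gs gt] /= /gwa_ext fg.
case: _ / fg gs gt => gs gt.
by rewrite (Prop_irrelevance fs gs) (Prop_irrelevance ft gt).
Qed.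

Definition gcat1_id (C : gcat1) : gcat1_hom C C :=
  @GCat1Hom C C (idfun : {gwa C -> C}) (fun=> erefl) (fun=> erefl).

Section Gcat1Comp.
Variables (C D E : gcat1) (g : gcat1_hom D E) (f : gcat1_hom C D).

Let gf : {gwa C -> E} := (g : {gwa D -> E}) \o (f : {gwa C -> D}).

Let comp_s : gf \o gcat1_s C =1 gcat1_s E \o gf.
Proof.
by move=> x; have /= -> := gcat1_hom_s f x; have /= -> := gcat1_hom_s g (f x).
Qed.

Let comp_t : gf \o gcat1_t C =1 gcat1_t E \o gf.
Proof.
by move=> x; have /= -> := gcat1_hom_t f x; have /= -> := gcat1_hom_t g (f x).
Qed.

Definition gcat1_comp : gcat1_hom C E := GCat1Hom comp_s comp_t.

End Gcat1Comp.

Definition gcat1_cat : category.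
Proof.
by apply: (@Category gcat1 gcat1_hom gcat1_id gcat1_comp) => *;
  apply: gcat1_hom_ext.
Defined.

(* A generalized crossed module structure on given groups with action [A] and
   [B]; the morphism A -> B is only required to be a group homomorphism. *)
Record gxmod_on (A B : gwaType) := GXModOn {
  gxmod_alpha : {multiplicative A -> B};
  gxmod_act : B -> A -> A;
  gxmod_actP : is_group_action gxmod_act;
  gxmod_alpha_act : forall b a,
    gxmod_alpha (gxmod_act b a) = selfact b (gxmod_alpha a);
  gxmod_peiffer : forall a a1, gxmod_act (gxmod_alpha a) a1 = selfact a a1 }.

Record gxmod := GXMod {
  gxmod_dom : gwaType;
  gxmod_cod : gwaType;
  gxmod_str :> gxmod_on gxmod_dom gxmod_cod }.

Record gxmod_hom (X Y : gxmod) := GXModHom {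
  gxmod_hom1 : {multiplicative gxmod_dom X -> gxmod_dom Y};
  gxmod_hom2 : {multiplicative gxmod_cod X -> gxmod_cod Y};
  gxmod_hom_alpha :
    gxmod_hom2 \o gxmod_alpha X =1 gxmod_alpha Y \o gxmod_hom1;
  gxmod_hom_act : forall b a,
    gxmod_hom1 (gxmod_act X b a) = gxmod_act Y (gxmod_hom2 b) (gxmod_hom1 a) }.

Lemma gxmod_hom_ext (X Y : gxmod) (u v : gxmod_hom X Y) :
  gxmod_hom1 u =1 gxmod_hom1 v -> gxmod_hom2 u =1 gxmod_hom2 v -> u = v.
Proof.
case: u v => [f g ga fa] [f' g' ga' fa'] /=.
move=> /multiplicative_ext ff /multiplicative_ext gg.
case: _ / ff ga' fa' => ga' fa'; case: _ / gg ga' fa' => ga' fa'.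
by rewrite (Prop_irrelevance ga ga') (Prop_irrelevance fa fa').
Qed.

Definition gxmod_id (X : gxmod) : gxmod_hom X X :=
  @GXModHom X X (idfun : {multiplicative _ -> _})
    (idfun : {multiplicative _ -> _}) (fun=> erefl) (fun _ _ => erefl).

Section GXModComp.
Variables (X Y Z : gxmod) (v : gxmod_hom Y Z) (u : gxmod_hom X Y).

Let vu1 : {multiplicative gxmod_dom X -> gxmod_dom Z} :=
  gxmod_hom1 v \o gxmod_hom1 u.
Let vu2 : {multiplicative gxmod_cod X -> gxmod_cod Z} :=
  gxmod_hom2 v \o gxmod_hom2 u.

Let comp_alpha : vu2 \o gxmod_alpha X =1 gxmod_alpha Z \o vu1.
Proof.
move=> a; have /= -> := gxmod_hom_alpha u a.
by have /= -> := gxmod_hom_alpha v (gxmod_hom1 u a).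
Qed.

Let comp_act b a : vu1 (gxmod_act X b a) = gxmod_act Z (vu2 b) (vu1 a).
Proof. by rewrite /= !gxmod_hom_act. Qed.

Definition gxmod_comp : gxmod_hom X Z := GXModHom comp_alpha comp_act.

End GXModComp.

Definition gxmod_cat : category.
Proof.
by apply: (@Category gxmod gxmod_hom gxmod_id gxmod_comp) => *;
  apply: gxmod_hom_ext.
Defined.

(* Main.v *)
Require Import Defs.
From HB Require Import structures.
From mathcomp Require Import all_boot.
From mathcomp Require Import boolp classical_sets.

(** The only axiom of a crossed module that needs an idea is the Peiffer
identity: [t] is idempotent, so [a^-1 * t a] lies in [ker t], hence acts
trivially on [ker s], and therefore [t a = a * (a^-1 * t a)] acts on [ker s] as
[a] does. *)

Set Implicit Arguments.
Unset Strict Implicit.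
Unset Printing Implicit Defensive.

Local Open Scope group_scope.

Lemma multiplicative1 (G H : groupType) (f : {multiplicative G -> H}) : f 1 = 1.
Proof. by apply: (@mulgI _ (f 1)); rewrite -gmulfM !mulg1. Qed.

Lemma multiplicativeV (G H : groupType) (f : {multiplicative G -> H}) x :
  f x^-1 = (f x)^-1.
Proof.
by apply: (@mulgI _ (f x)); rewrite -gmulfM !mulgV multiplicative1.
Qed.

Section Gcat1ToGXMod.
Variable C : gcat1.
Local Notation s := (gcat1_s C).
Local Notation t := (gcat1_t C).
Local Notation K := (gwa_ker s).
Local Notation I := (gwa_im s).

(** From [st = t] and [ts = s]: [tt = t(st) = (ts)t = st = t]. *)
Lemma gcat1_tt x : t (t x) = t x.
Proof.
have /= st : s (t x) = t x := gcat1_st x.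
by rewrite -[in LHS]st -[in RHS]st; exact: gcat1_ts.
Qed.

(** A restatement of [ts = s]; it gives the equivariance of the boundary map. *)
Lemma gcat1_t_im (y : I) : t (sval y) = sval y.
Proof. by case: y => y /= /set_mem[x _ <-]; exact: gcat1_ts. Qed.

Lemma gcat1_selfact_t (a x : C) : s x = 1 -> selfact (t a) x = selfact a x.
Proof.
(* Factor [t a] as [a * (a^-1 * t a)]; it remains to see that the second factor fixes [x]. *)
move=> sx; rewrite -[t a](mulVKg a) (group_actM selfactP); congr selfact.
apply: gcat1_ker => //.
by rewrite gmulfM multiplicativeV /= gcat1_tt mulVg.
Qed.

Let alpha_subproof (a : K) : t (sval a) \in range s.
(* Since [st = t], the element [t a] is its own preimage under [s]. *)
Proof. by apply/mem_set; exists (t (sval a)); last exact: gcat1_st. Qed.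

Definition gcat1_alpha (a : K) : I := Sub (t (sval a)) (alpha_subproof a).

Let alphaM : {morph gcat1_alpha : a b / a * b}.
Proof. by move=> a b; apply: val_inj; rewrite /= gmulfM. Qed.
HB.instance Definition _ := isMultiplicative.Build K I gcat1_alpha alphaM.

Let act_subproof (b : I) (a : K) : s (selfact (sval b) (sval a)) == 1.
Proof.
rewrite gwa_selfact (eqP (valP a)); apply/eqP.
(* What is left is that an automorphism fixes [1]: its value [u] at [1] satisfies [u * u = u], and
   [u] cancels. *)
apply: (@mulgI _ (selfact (s (sval b)) 1)).
by rewrite -(group_act_morph selfactP) !mulg1.
Qed.

Definition gcat1_act (b : I) (a : K) : K :=
  Sub (selfact (sval b) (sval a)) (act_subproof b a).

Let actP : is_group_action gcat1_act.
Proof.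
split=> [a|b c a|b a a']; apply: val_inj => /=.
- exact: (group_act1 selfactP).
- exact: (group_actM selfactP).
- exact: (group_act_morph selfactP).
Qed.

(** [t] preserves the self-action and fixes [b], which lies in the image of [s]. *)
Let alpha_act b a : gcat1_alpha (gcat1_act b a) = selfact b (gcat1_alpha a).
Proof. by apply: val_inj; rewrite /= gwa_selfact gcat1_t_im. Qed.

Let peiffer a a1 : gcat1_act (gcat1_alpha a) a1 = selfact a a1.
Proof. by apply: val_inj; apply: gcat1_selfact_t; apply/eqP/(valP a1). Qed.

Definition gcat1_gxmod_on : gxmod_on K I :=
  @GXModOn K I gcat1_alpha gcat1_act actP alpha_act peiffer.

End Gcat1ToGXMod.

Section Gcat1HomToGXModHom.
Variables (C D : gcat1) (f : gcat1_hom C D).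
Local Notation kerC := (gwa_ker (gcat1_s C)).
Local Notation kerD := (gwa_ker (gcat1_s D)).
Local Notation imC := (gwa_im (gcat1_s C)).
Local Notation imD := (gwa_im (gcat1_s D)).

Let ker_subproof (a : kerC) : gcat1_s D (f (sval a)) == 1.
Proof.
(* Commuting [f] past [s] turns the goal into [f (s a) = 1], where [s a = 1]. *)
have /= <- := gcat1_hom_s f (sval a).
by rewrite (eqP (valP a)) multiplicative1.
Qed.

Definition gcat1_hom_ker (a : kerC) : kerD := Sub (f (sval a)) (ker_subproof a).

Let im_subproof (b : imC) : f (sval b) \in range (gcat1_s D).
Proof.
(* If [b = s x], then [f b = s (f x)]. *)
case: b => b /= /set_mem[x _ <-]; apply/mem_set; exists (f x) => //.
by have /= -> := gcat1_hom_s f x.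
Qed.

Definition gcat1_hom_im (b : imC) : imD := Sub (f (sval b)) (im_subproof b).

Let kerM : {morph gcat1_hom_ker : a b / a * b}.
Proof. by move=> a b; apply: val_inj; rewrite /= gmulfM. Qed.
HB.instance Definition _ := isMultiplicative.Build kerC kerD gcat1_hom_ker kerM.

Let imM : {morph gcat1_hom_im : a b / a * b}.
Proof. by move=> a b; apply: val_inj; rewrite /= gmulfM. Qed.
HB.instance Definition _ := isMultiplicative.Build imC imD gcat1_hom_im imM.

Let hom_alpha :
  gcat1_hom_im \o @gcat1_alpha C =1 @gcat1_alpha D \o gcat1_hom_ker.
Proof. by move=> a; apply: val_inj; exact: (gcat1_hom_t f). Qed.

Let hom_act b a : gcat1_hom_ker (gcat1_act b a) =
  gcat1_act (gcat1_hom_im b) (gcat1_hom_ker a).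
Proof. by apply: val_inj; rewrite /= gwa_selfact. Qed.

Definition gcat1_gxmod_hom :
    gxmod_hom (GXMod (gcat1_gxmod_on C)) (GXMod (gcat1_gxmod_on D)) :=
  @GXModHom (GXMod (gcat1_gxmod_on C)) (GXMod (gcat1_gxmod_on D))
    gcat1_hom_ker gcat1_hom_im hom_alpha hom_act.

End Gcat1HomToGXModHom.

(** Both components restrict [f], so the functor laws hold by computation on underlying elements.
    The definition stays transparent so that [fmap] unfolds to these restrictions. *)
Definition gcat1_gxmod_functor :
  @functor_on gcat1_cat gxmod_cat (fun C : gcat1 => GXMod (gcat1_gxmod_on C)).
Proof.
by apply: (@FunctorOn gcat1_cat gxmod_cat _ gcat1_gxmod_hom) => *;
  apply: gxmod_hom_ext => x; apply: val_inj.
Defined.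

(** As [sval] is injective, the equations on underlying elements determine the boundary map, the
    action and the functor on morphisms. *)
Theorem mainTheorem3 :
  exists X : forall C : gcat1, gxmod_on (gwa_ker (gcat1_s C)) (gwa_im (gcat1_s C)),
    [/\ forall (C : gcat1) (g : gwa_ker (gcat1_s C)),
          sval (gxmod_alpha (X C) g) = gcat1_t C (sval g),
        forall (C : gcat1) (x : gwa_im (gcat1_s C)) (g : gwa_ker (gcat1_s C)),
          sval (gxmod_act (X C) x g) = selfact (sval x) (sval g)
      & exists F : @functor_on gcat1_cat gxmod_cat (fun C : gcat1 => GXMod (X C)),
          forall (C D : gcat1) (f : gcat1_hom C D),
            (forall g : gwa_ker (gcat1_s C),
               sval (gxmod_hom1 (fmap F f) g) = f (sval g))
            /\ (forall x : gwa_im (gcat1_s C),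
               sval (gxmod_hom2 (fmap F f) x) = f (sval x))].
Proof.
exists gcat1_gxmod_on; split=> //.
by exists gcat1_gxmod_functor.
Qed.
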